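(* Suppose $\boldsymbol Z:=[\boldsymbol z_1|\cdots|\boldsymbol z_n]^{\mathsf T}\in\mathbb{R}^{n\times d}$ and $\boldsymbol\lambda\in\mathbb{R}_{++}^d$ are such that $\boldsymbol Z\,\mathrm{diag}(\boldsymbol\lambda)\boldsymbol Z^{\mathsf T}$ and $\boldsymbol Z_{\backslash i}\,\mathrm{diag}(\boldsymbol\lambda)\boldsymbol Z_{\backslash i}^{\mathsf T}$ for all $i=1,\dots,n$ are non-singular. Let the training data $(\boldsymbol x_1,y_1),\dots,(\boldsymbol x_n,y_n)\in\mathbb{R}^d\times\{-1,+1\}$ satisfy $\boldsymbol x_i=\mathrm{diag}(\boldsymbol\lambda)^{1/2}\boldsymbol z_i$ for each $i=1,\dots,n$, and let $\boldsymbol K=\boldsymbol Z\,\mathrm{diag}(\boldsymbol\lambda)\boldsymbol Z^{\mathsf T}$ and $\boldsymbol y=(y_1,\dots,y_n)\in\mathbb{R}^n$. Then the following are equivalent: 1. Every training example is a support vector. 2. The vector $\boldsymbol\beta:=\boldsymbol K^{-1}\boldsymbol y$ satisfies $y_i\beta_i>0$ for all $i=1,\dots,n$. 3. $y_i\,\boldsymbol y_{\backslash i}^{\mathsf T}\left(\boldsymbol Z_{\backslash i}\,\mathrm{diag}(\boldsymbol\lambda)\boldsymbol Z_{\backslash i}^{\mathsf T}\right)^{-1}\boldsymbol Z_{\backslash i}\,\mathrm{diag}(\boldsymbol\lambda)\boldsymbol z_i<1$ for all $i=1,\dots,n$.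
   Context: $\mathbb{R}_{++}=\{x\in\mathbb{R}:x>0\}$. $\boldsymbol y_{\backslash i}\in\mathbb{R}^{n-1}$ is $\boldsymbol y$ with the $i$-th coordinate omitted, and $\boldsymbol Z_{\backslash i}\in\mathbb{R}^{(n-1)\times d}$ is $\boldsymbol Z$ with the $i$-th row omitted. Support vectors: the (hard-margin, homogeneous) SVM problem is $\min_{\boldsymbol w\in\mathbb{R}^d}\frac12\|\boldsymbol w\|_2^2$ subject to $y_i\boldsymbol x_i^{\mathsf T}\boldsymbol w\ge1$ for all $i$. Since $K_{i,j}=\boldsymbol x_i^{\mathsf T}\boldsymbol x_j$, its Lagrangian dual is $\max_{\boldsymbol\alpha\in\mathbb{R}^n}\sum_{i=1}^n\alpha_i-\frac12\boldsymbol\alpha^{\mathsf T}\mathrm{diag}(\boldsymbol y)^{\mathsf T}\boldsymbol K\,\mathrm{diag}(\boldsymbol y)\boldsymbol\alpha$ subject to $\alpha_i\ge0$ for all $i$. The support vectors are the examples $(\boldsymbol x_i,y_i)$ with $\alpha_i^\star>0$, where $\boldsymbol\alpha^\star$ is the optimal dual solution (unique since $\boldsymbol K$ is non-singular). *)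

(* Defs.v *)
From mathcomp Require Export all_boot all_order all_algebra.
From mathcomp Require Export reals.

Set Implicit Arguments.
Unset Strict Implicit.
Unset Printing Implicit Defensive.

Import Order.TTheory GRing.Theory Num.Theory.
Local Open Scope ring_scope.

(* The vectors of the mathematics are columns: [y], [alpha] : 'cV_n. Data are
   stored as the rows of a matrix, so the i-th data vector is [(row i X)^T]. *)

Definition weighted_gram (R : realType) (n d : nat)
    (Z : 'M[R]_(n, d)) (lam : 'rV[R]_d) : 'M[R]_n :=
  Z *m diag_mx lam *m Z^T.

Definition svm_dual_objective (R : realType) (n : nat)
    (K : 'M[R]_n) (y alpha : 'cV[R]_n) : R :=
  \sum_(i < n) alpha i 0
  - 2^-1 * (alpha^T *m (diag_mx y^T)^T *m K *m diag_mx y^T *m alpha) 0 0.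

Definition svm_dual_feasible (R : realType) (n : nat) (alpha : 'cV[R]_n) : Prop :=
  forall i : 'I_n, 0 <= alpha i 0.

Definition svm_dual_optimal (R : realType) (n : nat)
    (K : 'M[R]_n) (y alpha : 'cV[R]_n) : Prop :=
  svm_dual_feasible alpha /\
  forall alpha' : 'cV[R]_n, svm_dual_feasible alpha' ->
    svm_dual_objective K y alpha' <= svm_dual_objective K y alpha.

(* [X *m X^T] has (i, j) entry x_i^T x_j. "The" dual optimum is rendered as a
   definite description: [unique] requires [alpha] to be the only optimum. *)
Definition support_vector (R : realType) (n d : nat)
    (X : 'M[R]_(n, d)) (y : 'cV[R]_n) (i : 'I_n) : Prop :=
  exists alpha : 'cV[R]_n,
    unique (svm_dual_optimal (X *m X^T) y) alpha /\ 0 < alpha i 0.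

(* Main.v *)
Require Import Defs.
From mathcomp Require Import ring lra.

Set Implicit Arguments.
Unset Strict Implicit.
Unset Printing Implicit Defensive.

(** Write D for the diagonal matrix of y, so that D is an involution, and note
    that K = X X^T is positive definite because it is an invertible Gram matrix.

    Completing the square, the dual objective at alpha equals a constant minus
    half of q (D alpha - beta), where q is the quadratic form of K and
    beta = K^-1 y [dual_objectiveE]. Hence D beta, whose coordinates are
    y_i beta_i, is the maximiser over the whole space. If it is positive it is
    the unique dual optimum and every example is a support vector
    [diag_beta_optimal]. Conversely, if every example is a support vector, the
    optimum is interior to the feasible cone, and a concave quadratic maximised
    at an interior point is maximised there globally, so the optimum is D beta
    [interior_optimum].

    For the leave-one-out condition, let A be K without row and column i and k
    be column i of K without its i-th entry. Eliminating the other coordinates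
    from K beta = y gives s beta_i = y_i - y_{\i}^T A^-1 k, where s is the Schur
    complement of A [schur_coordE]. Multiplying by y_i and using y_i^2 = 1,
    s (y_i beta_i) = 1 - y_i y_{\i}^T A^-1 k; and s > 0 because it is a value of
    q at a nonzero vector. So y_i beta_i > 0 holds iff the leave-one-out
    quantity is less than 1, separately for each i. *)

Import Order.TTheory GRing.Theory Num.Theory.
Local Open Scope ring_scope.

(** * Quadratic forms and Gram matrices *)

Definition quad_form (R : realType) (n : nat) (K : 'M[R]_n) (v : 'cV[R]_n) : R :=
  (v^T *m K *m v) 0 0.

Definition pos_def (R : realType) (n : nat) (K : 'M[R]_n) : Prop :=
  forall v : 'cV[R]_n, v != 0 -> 0 < quad_form K v.

Lemma pos_def_ge0 (R : realType) (n : nat) (K : 'M[R]_n) (v : 'cV[R]_n) :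
  pos_def K -> 0 <= quad_form K v.
Proof.
move=> Kpos; have [->|/Kpos/ltW//] := eqVneq v 0.
by rewrite /quad_form mulmx0 mxE.
Qed.

Lemma pos_def_eq0 (R : realType) (n : nat) (K : 'M[R]_n) (v : 'cV[R]_n) :
  pos_def K -> quad_form K v <= 0 -> v = 0.
Proof.
by move=> Kpos qv; apply/eqP/negPn/negP => /Kpos; rewrite ltNge qv.
Qed.

Lemma quad_formZ (R : realType) (n : nat) (K : 'M[R]_n) (c : R) (v : 'cV[R]_n) :
  quad_form K (c *: v) = c ^+ 2 * quad_form K v.
Proof.
by rewrite /quad_form [(c *: v)^T]linearZ /= -!scalemxAl -scalemxAr scalerA mxE expr2.
Qed.

Lemma sym_bilinC (R : realType) (n : nat) (K : 'M[R]_n) (u v : 'cV[R]_n) :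
  K^T = K -> (u^T *m K *m v) 0 0 = (v^T *m K *m u) 0 0.
Proof.
move=> Ksym; have -> : v^T *m K *m u = (u^T *m K *m v)^T.
  by rewrite !trmx_mul trmxK Ksym mulmxA.
by rewrite [RHS]mxE.
Qed.

Lemma quad_formB (R : realType) (n : nat) (K : 'M[R]_n) (u v : 'cV[R]_n) :
  K^T = K ->
  quad_form K (u - v)
  = quad_form K u - 2 * (v^T *m K *m u) 0 0 + quad_form K v.
Proof.
move=> Ksym; rewrite /quad_form [(u - v)^T]linearB /= !mulmxBl !mulmxBr.
have := sym_bilinC u v Ksym; rewrite !mxE => ->; ring.
Qed.

Lemma gram_sym (R : realType) (n d : nat) (X : 'M[R]_(n, d)) :
  (X *m X^T)^T = X *m X^T.
Proof. by rewrite trmx_mul trmxK. Qed.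

(** The quadratic form of a Gram matrix is v |-> |X^T v|^2. It is nonnegative,
    and where it vanishes so does X^T v, hence also X X^T v. *)
Lemma gram_pos_def (R : realType) (n d : nat) (X : 'M[R]_(n, d)) :
  X *m X^T \in unitmx -> pos_def (X *m X^T).
Proof.
move=> XX v vn0; pose w := X^T *m v.
have qE : quad_form (X *m X^T) v = \sum_j w j 0 ^+ 2.
  have -> : quad_form (X *m X^T) v = (w^T *m w) 0 0.
    by rewrite /quad_form /w trmx_mul trmxK !mulmxA.
  by rewrite mxE; apply: eq_bigr => j _; rewrite mxE expr2.
have q_ge0 : 0 <= quad_form (X *m X^T) v.
  by rewrite qE sumr_ge0 // => j _; rewrite sqr_ge0.
rewrite lt_neqAle q_ge0 andbT eq_sym qE; apply: contra vn0.
rewrite psumr_eq0 => [/allP w0|j _]; last exact: sqr_ge0.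
have {}w0 : w = 0.
  apply/colP => j; rewrite [RHS]mxE; apply/eqP.
  by have := w0 j (mem_index_enum j); rewrite /= sqrf_eq0.
by rewrite -(mulKmx XX v) -mulmxA -/w w0 !mulmx0.
Qed.

(** * The weighted Gram matrix and its principal submatrices *)

Lemma scaled_rows_gram (R : realType) (n d : nat)
    (Z X : 'M[R]_(n, d)) (lam : 'rV[R]_d) :
  (forall j, 0 <= lam 0 j) ->
  (forall i, (row i X)^T = diag_mx (map_mx Num.sqrt lam) *m (row i Z)^T) ->
  X *m X^T = weighted_gram Z lam.
Proof.
move=> lam_ge0 X_def; set s := map_mx Num.sqrt lam in X_def.
have -> : X = Z *m diag_mx s.
  apply/row_matrixP => i; apply: trmx_inj.
  by rewrite X_def row_mul trmx_mul tr_diag_mx.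
rewrite /weighted_gram trmx_mul tr_diag_mx !mulmxA -(mulmxA Z) mulmx_diag.
congr (_ *m diag_mx _ *m _); apply/rowP => j.
by rewrite !mxE -expr2 sqr_sqrtr.
Qed.

Lemma row'E (R : realType) (n m : nat) (i : 'I_n) (A : 'M[R]_(n, m)) :
  row' i A = row' i 1%:M *m A.
Proof. by rewrite !row'Esub mul_rowsub_mx mul1mx. Qed.

Lemma weighted_gramM (R : realType) (m n d : nat)
    (P : 'M[R]_(m, n)) (Z : 'M[R]_(n, d)) (lam : 'rV[R]_d) :
  weighted_gram (P *m Z) lam = P *m weighted_gram Z lam *m P^T.
Proof. by rewrite /weighted_gram trmx_mul !mulmxA. Qed.

(** The column u with entry 1 at i and - A^-1 k elsewhere, where A is K without
    row and column i and k is column i of K without its i-th entry. Block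
    elimination gives K u = s e_i with s = u^T K u the Schur complement of A, so
    pairing K u with any beta isolates the coordinate beta_i. *)
Definition schur_vector (R : realType) (n : nat) (K : 'M[R]_n) (i : 'I_n) :
    'cV[R]_n :=
  let P := row' i 1%:M in
  delta_mx i 0 - P^T *m invmx (P *m K *m P^T) *m P *m K *m delta_mx i 0.

Lemma row'_delta (R : realType) (n : nat) (i : 'I_n) :
  row' i 1%:M *m delta_mx i 0 = 0 :> 'cV[R]_n.-1.
Proof.
by rewrite -row'E; apply/colP => j; rewrite !mxE eq_sym (negPf (neq_lift _ _)).
Qed.

Lemma schur_vector_diag (R : realType) (n : nat) (K : 'M[R]_n) (i : 'I_n) :
  schur_vector K i i 0 = 1.
Proof.
have -> : schur_vector K i i 0
          = ((delta_mx i 0 : 'cV[R]_n)^T *m schur_vector K i) 0 0.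
  by rewrite trmx_delta -rowE [RHS]mxE.
rewrite /schur_vector mulmxBr !mulmxA -trmx_mul row'_delta trmx0 !mul0mx subr0.
by rewrite trmx_delta -rowE !mxE !eqxx.
Qed.

Lemma mul_schur_vector (R : realType) (n : nat) (K : 'M[R]_n) (i : 'I_n) :
  row' i 1%:M *m K *m (row' i 1%:M)^T \in unitmx ->
  K *m schur_vector K i
  = quad_form K (schur_vector K i) *: delta_mx i 0.
Proof.
move=> A_unit; set u := schur_vector K i.
have Ku0 : row' i (K *m u) = 0.
  rewrite row'E /u /schur_vector !mulmxBr !mulmxA mulmxV //.
  by rewrite mul1mx subrr.
have KuE : K *m u = (K *m u) i 0 *: delta_mx i 0.
  apply/colP => j; rewrite [RHS]mxE [delta_mx _ _ _ _]mxE eqxx andbT.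
  case: (unliftP i j) => [k|] ->; last by rewrite eqxx mulr1.
  rewrite eq_sym (negPf (neq_lift _ _)) mulr0.
  by move/colP: Ku0 => /(_ k); rewrite mxE [RHS]mxE.
suff -> : quad_form K u = (K *m u) i 0 by [].
rewrite /quad_form -mulmxA {1}KuE -scalemxAr [LHS]mxE -colE.
by rewrite [col _ _ _ _]mxE [_^T _ _]mxE schur_vector_diag mulr1.
Qed.

(** Both sides are u^T K beta for u = schur_vector K i: on the left through
    K u = (u^T K u) e_i, on the right through K beta = y. *)
Lemma schur_coordE (R : realType) (n : nat) (K : 'M[R]_n) (i : 'I_n)
    (y beta : 'cV[R]_n) :
  K^T = K -> row' i 1%:M *m K *m (row' i 1%:M)^T \in unitmx ->
  K *m beta = y ->
  quad_form K (schur_vector K i) * beta i 0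
  = y i 0 - ((row' i y)^T *m invmx (row' i 1%:M *m K *m (row' i 1%:M)^T)
             *m row' i K *m (delta_mx i 0 : 'cV[R]_n)) 0 0.
Proof.
move=> Ksym A_unit Kb; set u := schur_vector K i.
have -> : quad_form K u * beta i 0 = (beta^T *m (K *m u)) 0 0.
  by rewrite mul_schur_vector // -scalemxAr [RHS]mxE -colE !mxE.
have bK : beta^T *m K = y^T by rewrite -Kb trmx_mul Ksym.
rewrite mulmxA bK /u /schur_vector mulmxBr [LHS]mxE.
rewrite -(colE i y^T) [col _ _ _ _]mxE [y^T _ _]mxE [X in _ + X]mxE.
by rewrite (row'E i y) (row'E i K) trmx_mul !mulmxA.
Qed.

(** * The dual problem *)

Section SignedData.
Variables (R : realType) (n : nat) (K : 'M[R]_n) (y beta : 'cV[R]_n).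
Hypothesis y_sign : forall i, y i 0 = -1 \/ y i 0 = 1.
Hypothesis Ksym : K^T = K.
Hypothesis Kpos : pos_def K.
Hypothesis Kbeta : K *m beta = y.

Let D := diag_mx y^T.

Lemma sign_sqr i : y i 0 * y i 0 = 1.
Proof. by case: (y_sign i) => ->; rewrite ?mulrNN mulr1. Qed.

Lemma sign_diagK (v : 'cV[R]_n) : D *m (D *m v) = v.
Proof.
by apply/colP => i; rewrite !mul_diag_mx !mxE mulrA sign_sqr mul1r.
Qed.

(** Completing the square: sum_i alpha_i = y^T D alpha = beta^T K D alpha. *)
Lemma dual_objectiveE (alpha : 'cV[R]_n) :
  svm_dual_objective K y alpha
  = 2^-1 * quad_form K beta - 2^-1 * quad_form K (D *m alpha - beta).
Proof.
rewrite quad_formB // /svm_dual_objective -/D.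
have -> : \sum_i alpha i 0 = (beta^T *m K *m (D *m alpha)) 0 0.
  have -> : beta^T *m K = y^T by rewrite -Kbeta trmx_mul Ksym.
  rewrite mxE; apply: eq_bigr => i _.
  by rewrite mul_diag_mx !mxE mulrA sign_sqr mul1r.
have -> : alpha^T *m D^T *m K *m D *m alpha = (D *m alpha)^T *m K *m (D *m alpha).
  by rewrite trmx_mul !mulmxA.
rewrite /quad_form; lra.
Qed.

Lemma dual_objective_le (alpha alpha' : 'cV[R]_n) :
  (svm_dual_objective K y alpha' <= svm_dual_objective K y alpha)
  = (quad_form K (D *m alpha - beta) <= quad_form K (D *m alpha' - beta)).
Proof. by rewrite !dual_objectiveE; apply/idP/idP => ?; lra. Qed.

Lemma diag_beta_optimal :
  svm_dual_feasible (D *m beta) -> unique (svm_dual_optimal K y) (D *m beta).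
Proof.
have q0 : quad_form K (D *m (D *m beta) - beta) = 0.
  by rewrite sign_diagK subrr /quad_form mulmx0 mxE.
move=> feas; split=> [|alpha [_ /(_ _ feas)]].
  by split=> // alpha _; rewrite dual_objective_le q0 pos_def_ge0.
rewrite dual_objective_le q0 => /(pos_def_eq0 Kpos)/eqP.
by rewrite subr_eq0 => /eqP <-; rewrite sign_diagK.
Qed.

(** Moving from alpha a fraction t of the way to the unconstrained maximiser
    D beta multiplies the deficit by (1 - t)^2. From an interior alpha some
    t in ]0, 1] keeps the point feasible, so at an optimum the deficit is 0. *)
Lemma interior_optimum (alpha : 'cV[R]_n) :
  svm_dual_optimal K y alpha -> (forall i, 0 < alpha i 0) ->
  alpha = D *m beta.
Proof.
move=> [_ opt] a_gt0; pose astar := D *m beta.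
pose S := \sum_j `|astar j 0| / alpha j 0.
have term_ge0 j : 0 <= `|astar j 0| / alpha j 0.
  by rewrite divr_ge0 // ltW.
have S_ge0 : 0 <= S by rewrite sumr_ge0.
have S1_gt0 : 0 < 1 + S by rewrite ltr_wpDr.
(* With t = 1 / (1 + S), coordinate i of the new point is
   t (S alpha_i + astar_i), and S alpha_i >= |astar_i|. *)
pose t := (1 + S)^-1.
have t_gt0 : 0 < t by rewrite invr_gt0.
have t_le1 : t <= 1 by rewrite invf_le1 // lerDl.
have tS : 1 - t = t * S by rewrite /t; field; rewrite gt_eqF.
pose alpha' := (1 - t) *: alpha + t *: astar.
have feas : svm_dual_feasible alpha'.
  move=> i; rewrite /alpha' tS 3!mxE.
  rewrite -mulrA -mulrDr mulr_ge0 ?(ltW t_gt0) //.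
  have : `|astar i 0| <= S * alpha i 0.
    by rewrite -ler_pdivrMr // /S (bigD1 i) //= lerDl sumr_ge0.
  by have := ler_norm (- astar i 0); rewrite normrN; lra.
have := opt _ feas; rewrite dual_objective_le.
have -> : D *m alpha' - beta = (1 - t) *: (D *m alpha - beta).
  rewrite /alpha' mulmxDr -!scalemxAr /astar sign_diagK scalerBr.
  by rewrite (scalerBl 1 t beta) scale1r opprB addrA -addrA.
rewrite quad_formZ => q_le.
have : quad_form K (D *m alpha - beta) <= 0.
  rewrite leNgt; apply/negP => q_gt0; move: q_le.
  by rewrite ler_pMl // real_leNgt ?num_real // expr_lt1 ?subr_ge0 // gtrBl t_gt0.
move=> /(pos_def_eq0 Kpos)/eqP; rewrite subr_eq0 => /eqP <-.
by rewrite sign_diagK.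
Qed.

End SignedData.

Theorem lemma1 (R : realType) (n d : nat)
    (Z : 'M[R]_(n, d)) (lam : 'rV[R]_d)
    (lam_gt0 : forall j : 'I_d, 0 < lam 0 j)
    (K_unit : weighted_gram Z lam \in unitmx)
    (Ki_unit : forall i : 'I_n, weighted_gram (row' i Z) lam \in unitmx)
    (X : 'M[R]_(n, d)) (y : 'cV[R]_n)
    (y_sign : forall i : 'I_n, y i 0 = -1 \/ y i 0 = 1)
    (X_def : forall i : 'I_n,
       (row i X)^T = diag_mx (map_mx Num.sqrt lam) *m (row i Z)^T)
    (K : 'M[R]_n) (K_def : K = weighted_gram Z lam)
    (beta : 'cV[R]_n) (beta_def : beta = invmx K *m y) :
  [<-> forall i : 'I_n, support_vector X y i;
       forall i : 'I_n, 0 < y i 0 * beta i 0;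
       forall i : 'I_n,
         y i 0 * ((row' i y)^T *m invmx (weighted_gram (row' i Z) lam)
                  *m row' i Z *m diag_mx lam *m (row i Z)^T) 0 0 < 1].
Proof.
have KX : X *m X^T = K.
  by rewrite K_def (scaled_rows_gram _ X_def) // => j; exact: ltW.
have Kunit : K \in unitmx by rewrite K_def.
have Ksym : K^T = K by rewrite -KX gram_sym.
have Kpos : pos_def K by rewrite -KX; apply: gram_pos_def; rewrite KX.
have Kbeta : K *m beta = y by rewrite beta_def mulKVmx.
have DbetaE i : (diag_mx y^T *m beta) i 0 = y i 0 * beta i 0.
  by rewrite mul_diag_mx !mxE.
have AE i : weighted_gram (row' i Z) lam
          = row' i 1%:M *m K *m (row' i 1%:M)^T.
  by rewrite row'E weighted_gramM K_def.
have s_gt0 i : 0 < quad_form K (schur_vector K i).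
  apply: Kpos; apply/eqP => u0; have := schur_vector_diag K i.
  by rewrite u0 mxE => /esym/eqP; rewrite oner_eq0.
have beta_iff i : (0 < y i 0 * beta i 0) =
    (y i 0 * ((row' i y)^T *m invmx (weighted_gram (row' i Z) lam)
                  *m row' i Z *m diag_mx lam *m (row i Z)^T) 0 0 < 1).
  have A_unit := Ki_unit i; rewrite AE in A_unit.
  have kE : row' i Z *m (diag_mx lam *m (row i Z)^T) = row' i K *m delta_mx i 0.
    rewrite (row'E i K) K_def /weighted_gram rowE trmx_mul trmx_delta.
    by rewrite (row'E i Z) !mulmxA.
  rewrite -!mulmxA kE !mulmxA AE.
  rewrite -(pmulr_rgt0 _ (s_gt0 i)) mulrCA (schur_coordE Ksym A_unit Kbeta).
  by rewrite mulrBr sign_sqr // subr_gt0.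
have sv_of_beta : (forall i, 0 < y i 0 * beta i 0) ->
    forall i, support_vector X y i.
  move=> yb i; exists (diag_mx y^T *m beta); split; last by rewrite DbetaE.
  rewrite KX; apply: diag_beta_optimal => // j.
  by rewrite DbetaE ltW.
tfae.
- (* Each example brings its own optimum; uniqueness identifies them all. *)
  move=> sv i; have [alpha [[opt uniq_alpha] _]] := sv i.
  have a_gt0 j : 0 < alpha j 0.
    by have [a [[a_opt _] a_j]] := sv j; rewrite (uniq_alpha a a_opt).
  rewrite KX in opt.
  by rewrite -DbetaE -(interior_optimum y_sign Ksym Kpos Kbeta opt).
- by move=> yb i; rewrite -beta_iff.
- by move=> lt1; apply: sv_of_beta => i; rewrite beta_iff.
Qed.
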